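(* Let $\mathcal{O}$ be an ontology (a finite set of DL-clauses), let $\mathcal{D}=\langle \mathcal{V},\mathcal{E},\mathcal{S},\mathsf{core},\succ\rangle$ be a context structure that is sound for $\mathcal{O}$, and let $\mathsf{strategy}$ be any expansion strategy. Then applying any of the inference rules Core, Hyper, Eq, Ineq, Factor, Elim, Pred, Succ (with the given expansion strategy used in the Succ rule) to $\mathcal{O}$ and $\mathcal{D}$ produces a context structure that is sound for $\mathcal{O}$.
   Context: **Syntax.** Let $\mathcal{P}_1,\mathcal{P}_2$ be countable sets of unary and binary predicate symbols and $\mathcal{F}$ a countable set of unary function symbols; there is also a special constant $\mathsf{true}$ of predicate sort. Terms are two-sorted: $\mathcal{F}$-terms are built from variables and $\mathcal{F}$; $\mathcal{P}$-terms have a predicate symbol applied (only at the outermost level) to $\mathcal{F}$-terms. An equality is $s\approx t$ with $s,t$ both $\mathcal{F}$-terms or both $\mathcal{P}$-terms (including $\mathsf{true}$); an inequality $s\not\approx t$ is its negation; both are implicitly symmetric; a literal is an equality or an inequality. An atom is an equality $A\approx\mathsf{true}$ with $A$ a $\mathcal{P}$-term, written just $A$. A clause is a universally quantified formula $\Gamma\rightarrow\Delta$ with $\Gamma$ (body) a conjunction of atoms and $\Delta$ (head) a disjunction of literals; conjunctions and disjunctions are treated as finite sets; $\top$ and $\bot$ are the empty conjunction and disjunction. $\models$ is entailment in first-order logic with equality. $s|_p$ is the subterm of $s$ at position $p$, $s[t]_p$ is the result of replacing it by $t$; $p$ is proper in $s$ if $s|_p\neq s$. **DL-clauses.** They use a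 central variable $x$ and variables $z_i$. A DL-literal is an atom of the form $B(z_i)$, $B(x)$, $B(f(x))$, $S(x,z_i)$, $S(z_i,x)$, $S(x,f(x))$, $S(f(x),x)$ with $B\in\mathcal{P}_1$, $S\in\mathcal{P}_2$, $f\in\mathcal{F}$, or a literal $f(x)\bowtie g(x)$, $f(x)\bowtie z_i$, $z_i\bowtie z_j$ with ${\bowtie}\in\{\approx,\not\approx\}$. A DL-clause has only atoms of the form $B(x)$, $S(x,z_i)$, $S(z_i,x)$ in the body, only DL-literals in the head, and each $z_i$ in the head also occurs in the body. An ontology is a finite set of DL-clauses. **Context clauses.** They use only variables $x$ and $y$. A context $\mathcal{F}$-term is $x$, $y$, or $f(x)$; a context $\mathcal{P}$-term is $B(y)$, $B(x)$, $B(f(x))$, $S(x,y)$, $S(y,x)$, $S(x,f(x))$, or $S(f(x),x)$; a context term is a context $\mathcal{F}$- or $\mathcal{P}$-term. A context literal is $A\approx\mathsf{true}$ with $A$ a context $\mathcal{P}$-term (a context atom), $f(x)\bowtie g(x)$, $f(x)\bowtie y$, or $y\bowtie y$. A context clause has only function-free context atoms in the body and only context literals in the head. **Triggers.** $\mathsf{Su}(\mathcal{O})$ is the smallest set of atoms such that for each $\Gamma\rightarrow\Delta\in\mathcal{O}$: $B(x)\in\Gamma$ implies $B(x)\in\mathsf{Su}(\mathcal{O})$; $S(x,z_i)\in\Gamma$ implies $S(x,y)\in\mathsf{Su}(\mathcal{O})$; $S(z_i,x)\in\Gamma$ implies $S(y,x)\in\mathsf{Su}(\mathcal{O})$. $\mathsf{Pr}(\mathcal{O})=\{A\{x\mapsto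 y,y\mapsto x\}\mid A\in\mathsf{Su}(\mathcal{O})\}\cup\{B(y)\mid B\text{ a unary predicate occurring in }\mathcal{O}\}$. **Context term orders.** Fix a total well-founded order $\gtrdot$ on function symbols. A context term order $\succ$ is a strict order on context terms such that: (1) $f(x)\succ x\succ y$ for each $f\in\mathcal{F}$; (2) $f\gtrdot g$ implies $f(x)\succ g(x)$; (3) $s_1\succ s_2$ implies $t[s_1]_p\succ t[s_2]_p$ for all terms $s_1,s_2,t$ and positions $p$ in $t$; (4) $s\succ s|_p$ for each term $s$ and proper position $p$; (5) for each atom $A\approx\mathsf{true}\in\mathsf{Pr}(\mathcal{O})$ and each context term $s\notin\{x,y\}$, $A\not\succ s$. The constant $\mathsf{true}$ is not a context term and is regarded as smaller than every $\mathcal{P}$-term. The order extends to literals by identifying $s\approx t$ with the multiset $\{s,t\}$ and $s\not\approx t$ with $\{s,s,t,t\}$ and using the multiset extension ($M\succ N$ iff $M\ne N$ and for each $n\in N\setminus M$ some $m\in M\setminus N$ has $m\succ n$). $\Delta\not\succeq L$ means that no $L'\in\Delta$ satisfies $L'\succeq L$. **Redundancy.** $\Gamma\rightarrow\Delta\mathrel{\hat\in}U$ (containment up to redundancy) holds if $\{s\approx s',s\not\approx s'\}\subseteq\Delta$ or $s\approx s\in\Delta$ for some terms $s,s'$, or if some $\Gamma'\rightarrow\Delta'\in U$ has $\Gamma'\subseteq\Gamma$ and $\Delta'\subseteq\Delta$. **Context structures.** A context structure for $\mathcal{O}$ is $\mathcal{D}=\langle\mathcal{V},\mathcal{E},\mathcal{S},\mathsf{core},\succ\rangle$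 with $\mathcal{V}$ a finite set of contexts, $\mathcal{E}\subseteq\mathcal{V}\times\mathcal{V}\times\mathcal{F}$ a finite set of labelled edges, and for each $v\in\mathcal{V}$: $\mathsf{core}_v$ a conjunction of atoms from $\mathsf{Su}(\mathcal{O})$, $\mathcal{S}_v$ a finite set of context clauses, $\succ_v$ a context term order. $\mathcal{D}$ is *sound* for $\mathcal{O}$ if (S1) $\mathcal{O}\models\mathsf{core}_v\wedge\Gamma\rightarrow\Delta$ for each $v\in\mathcal{V}$ and $\Gamma\rightarrow\Delta\in\mathcal{S}_v$; and (S2) $\mathcal{O}\models\mathsf{core}_u\rightarrow\mathsf{core}_v\{x\mapsto f(x),y\mapsto x\}$ for each $\langle u,v,f\rangle\in\mathcal{E}$. **Expansion strategies.** An expansion strategy is a polynomial-time computable function that maps a function symbol $f$, a set of atoms $K$, and a context structure $\mathcal{D}$ to a triple $\langle v,\mathsf{core}',\succ'\rangle$ where $\mathsf{core}'\subseteq K$, $\succ'$ is a context term order, and either $v\notin\mathcal{V}$ is fresh or $v\in\mathcal{V}$ with $\mathsf{core}_v=\mathsf{core}'$. **Inference rules** (let $\sigma_f=\{x\mapsto f(x),y\mapsto x\}$). - Core: if $A\in\mathsf{core}_v$ and $\top\rightarrow A\notin\mathcal{S}_v$, add $\top\rightarrow A$ to $\mathcal{S}_v$. - Hyper: if $\bigwedge_{i=1}^nA_i\rightarrow\Delta\in\mathcal{O}$, $\sigma$ is a substitution with $\sigma(x)=x$, $\Gamma_i\rightarrow\Delta_i\vee A_i\sigma\in\mathcal{S}_v$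 with $\Delta_i\not\succeq_vA_i\sigma$ for $1\le i\le n$, and $C=\bigwedge_i\Gamma_i\rightarrow\Delta\sigma\vee\bigvee_i\Delta_i$ is not $\hat\in\,\mathcal{S}_v$, add $C$ to $\mathcal{S}_v$. - Eq: if $\Gamma_1\rightarrow\Delta_1\vee s_1\approx t_1\in\mathcal{S}_v$ with $s_1\succ_vt_1$, $\Delta_1\not\succeq_vs_1\approx t_1$; $\Gamma_2\rightarrow\Delta_2\vee s_2\bowtie t_2\in\mathcal{S}_v$ with ${\bowtie}\in\{\approx,\not\approx\}$, $s_2\succ_vt_2$, $\Delta_2\not\succeq_vs_2\bowtie t_2$; $s_2|_p=s_1$; and $C=\Gamma_1\wedge\Gamma_2\rightarrow\Delta_1\vee\Delta_2\vee s_2[t_1]_p\bowtie t_2$ is not $\hat\in\,\mathcal{S}_v$, add $C$ to $\mathcal{S}_v$. - Ineq: if $\Gamma\rightarrow\Delta\vee t\not\approx t\in\mathcal{S}_v$ and $\Gamma\rightarrow\Delta$ is not $\hat\in\,\mathcal{S}_v$, add $\Gamma\rightarrow\Delta$ to $\mathcal{S}_v$. - Factor: if $\Gamma\rightarrow\Delta\vee s\approx t\vee s\approx t'\in\mathcal{S}_v$, $\Delta\cup\{s\approx t\}\not\succeq_vs\approx t'$, $s\succ_vt'$, and $C=\Gamma\rightarrow\Delta\vee t\not\approx t'\vee s\approx t'$ is not $\hat\in\,\mathcal{S}_v$, add $C$ to $\mathcal{S}_v$. - Elim: if $C\in\mathcal{S}_v$ and $C\mathrel{\hat\in}\mathcal{S}_v\setminus\{C\}$,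 remove $C$ from $\mathcal{S}_v$. - Pred: if $\langle u,v,f\rangle\in\mathcal{E}$, $\bigwedge_{i=1}^lA_i\rightarrow\bigvee_{i=l+1}^{l+n}A_i\in\mathcal{S}_v$, $\Gamma_i\rightarrow\Delta_i\vee A_i\sigma_f\in\mathcal{S}_u$ with $\Delta_i\not\succeq_uA_i\sigma_f$ for $1\le i\le l$, $A_i\in\mathsf{Pr}(\mathcal{O})$ for $l+1\le i\le l+n$, and $C=\bigwedge_{i=1}^l\Gamma_i\rightarrow\bigvee_{i=1}^l\Delta_i\vee\bigvee_{i=l+1}^{l+n}A_i\sigma_f$ is not $\hat\in\,\mathcal{S}_u$, add $C$ to $\mathcal{S}_u$. - Succ: let $K_1=\{A'\in\mathsf{Su}(\mathcal{O})\mid\top\rightarrow A'\sigma_f\in\mathcal{S}_u\}$ and $K_2=\{A'\in\mathsf{Su}(\mathcal{O})\mid\Gamma'\rightarrow\Delta'\vee A'\sigma_f\in\mathcal{S}_u\text{ and }\Delta'\not\succeq_uA'\sigma_f\text{ for some }\Gamma',\Delta'\}$. If $\Gamma\rightarrow\Delta\vee A\in\mathcal{S}_u$ with $\Delta\not\succeq_uA$ and $A$ containing $f(x)$, and no edge $\langle u,v,f\rangle\in\mathcal{E}$ exists such that $A'\rightarrow A'\mathrel{\hat\in}\mathcal{S}_v$ for each $A'\in K_2\setminus\mathsf{core}_v$, then let $\langle v,\mathsf{core}',\succ'\rangle=\mathsf{strategy}(f,K_1,\mathcal{D})$; if $v\in\mathcal{V}$, replace $\succ_v$ by $\succ_v\cap\succ'$;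 otherwise add $v$ to $\mathcal{V}$ with $\succ_v=\succ'$, $\mathsf{core}_v=\mathsf{core}'$, $\mathcal{S}_v=\emptyset$; then add the edge $\langle u,v,f\rangle$ to $\mathcal{E}$ and add $A'\rightarrow A'$ to $\mathcal{S}_v$ for each $A'\in K_2\setminus\mathsf{core}_v$. *)

(* Defs.v *)
From HB Require Import structures.
From mathcomp Require Import all_boot.
From mathcomp Require Import finmap multiset boolp.

Set Implicit Arguments.
Unset Strict Implicit.
Unset Printing Implicit Defensive.

Local Open Scope fmap_scope.
Local Open Scope fset_scope.

Inductive var : Type := X | Y | Z of nat.

Definition var_code (v : var) : nat :=
  match v with X => 0 | Y => 1 | Z i => i.+2 end.
Definition var_decode (n : nat) : var :=
  match n with 0 => X | 1 => Y | i.+2 => Z i end.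
Lemma var_codeK : cancel var_code var_decode. Proof. by case. Qed.
HB.instance Definition _ := Countable.copy var (can_type var_codeK).

(* [P1], [P2] are the unary and binary predicate symbols, [F] the unary
   function symbols. *)
Section Syntax.
Variables P1 P2 F : countType.

Inductive fterm : Type := Var of var | App of F & fterm.

Fixpoint fterm_code (t : fterm) : seq F * var :=
  match t with
  | Var v => ([::], v)
  | App f t => let: (s, v) := fterm_code t in (f :: s, v)
  end.
Definition fterm_decode (c : seq F * var) : fterm := foldr App (Var c.2) c.1.
Lemma fterm_codeK : cancel fterm_code fterm_decode.
Proof. by elim=> //= f t; rewrite /fterm_decode; case: fterm_code => s v /= ->. Qed.
HB.instance Definition _ := Countable.copy fterm (can_type fterm_codeK).

(* [true] is kept out of [pterm], so that [pterm] is also the type of atoms. *)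
Inductive pterm : Type :=
| Un of P1 & fterm
| Bin of P2 & fterm & fterm.

Definition pterm_code (A : pterm) : (P1 * fterm) + (P2 * fterm * fterm) :=
  match A with Un B t => inl (B, t) | Bin R s t => inr (R, s, t) end.
Definition pterm_decode (c : (P1 * fterm) + (P2 * fterm * fterm)) : pterm :=
  match c with inl (B, t) => Un B t | inr (R, s, t) => Bin R s t end.
Lemma pterm_codeK : cancel pterm_code pterm_decode. Proof. by case. Qed.
HB.instance Definition _ := Countable.copy pterm (can_type pterm_codeK).

Inductive term : Type := TF of fterm | TP of pterm | TTrue.

Definition term_code (s : term) : option (fterm + pterm) :=
  match s with TF t => Some (inl t) | TP A => Some (inr A) | TTrue => None end.
Definition term_decode (c : option (fterm + pterm)) : term :=
  match c with
  | Some (inl t) => TF t | Some (inr A) => TP A | None => TTrue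
  end.
Lemma term_codeK : cancel term_code term_decode. Proof. by case. Qed.
HB.instance Definition _ := Countable.copy term (can_type term_codeK).

(* (polarity, multiset of the two sides): the multiset makes the implicit
   symmetry of equalities and inequalities a syntactic identity.  Ill-sorted
   pairs and multisets not of size two are junk, excluded by [dl_literal] and
   [context_literal] below. *)
Definition literal : Type := (bool * {mset term}%mset)%type.
HB.instance Definition _ := Choice.on literal.

Definition lit (pos : bool) (s t : term) : literal := (pos, [mset s; t]%mset).
Definition eqlit := lit true.
Definition neqlit := lit false.
Definition atom (A : pterm) : literal := eqlit (TP A) TTrue.

(* body and head *)
Definition clause : Type := ({fset pterm} * {fset literal})%type.
HB.instance Definition _ := Choice.on clause.

Definition subst : Type := var -> fterm.

Fixpoint fsubst (sg : subst) (t : fterm) : fterm :=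
  match t with Var v => sg v | App f t => App f (fsubst sg t) end.
Definition psubst (sg : subst) (A : pterm) : pterm :=
  match A with
  | Un B t => Un B (fsubst sg t)
  | Bin R s t => Bin R (fsubst sg s) (fsubst sg t)
  end.
Definition tsubst (sg : subst) (s : term) : term :=
  match s with
  | TF t => TF (fsubst sg t) | TP A => TP (psubst sg A) | TTrue => TTrue
  end.
Definition lsubst (sg : subst) (L : literal) : literal :=
  (L.1, seq_mset [seq tsubst sg s | s <- enum_mset L.2]).

Definition sigma (f : F) : subst := fun v =>
  match v with X => App f (Var X) | Y => Var X | Z i => Var (Z i) end.
Definition swap_xy : subst := fun v =>
  match v with X => Var Y | Y => Var X | Z i => Var (Z i) end.

Fixpoint fvar (t : fterm) : var :=
  match t with Var v => v | App _ t => fvar t end.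
Definition pvars (A : pterm) : seq var :=
  match A with Un _ t => [:: fvar t] | Bin _ s t => [:: fvar s; fvar t] end.
Definition tvars (s : term) : seq var :=
  match s with TF t => [:: fvar t] | TP A => pvars A | TTrue => [::] end.
Definition occurs_lit (v : var) (L : literal) : Prop :=
  exists2 s, s \in L.2 & v \in tvars s.

(* Positions are sequences of argument indices, counted from 1. *)
Fixpoint fsubterm (t : fterm) (p : seq nat) : option fterm :=
  match p, t with
  | [::], _ => Some t
  | 1 :: q, App _ t => fsubterm t q
  | _, _ => None
  end.
Definition subterm (s : term) (p : seq nat) : option term :=
  match p, s with
  | [::], _ => Some s
  | _, TF t => omap TF (fsubterm t p)
  | 1 :: q, TP (Un _ t) => omap TF (fsubterm t q)
  | 1 :: q, TP (Bin _ t _) => omap TF (fsubterm t q)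
  | 2 :: q, TP (Bin _ _ t) => omap TF (fsubterm t q)
  | _, _ => None
  end.

Fixpoint freplace (t : fterm) (p : seq nat) (u : fterm) : option fterm :=
  match p, t with
  | [::], _ => Some u
  | 1 :: q, App f t => omap (App f) (freplace t q u)
  | _, _ => None
  end.
(* [replace s p u] is s[u]_p *)
Definition replace (s : term) (p : seq nat) (u : term) : option term :=
  match p, s, u with
  | [::], _, _ => Some u
  | _, TF t, TF u => omap TF (freplace t p u)
  | 1 :: q, TP (Un B t), TF u =>
      omap (fun t' => TP (Un B t')) (freplace t q u)
  | 1 :: q, TP (Bin R t1 t2), TF u =>
      omap (fun t' => TP (Bin R t' t2)) (freplace t1 q u)
  | 2 :: q, TP (Bin R t1 t2), TF u =>
      omap (fun t' => TP (Bin R t1 t')) (freplace t2 q u)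
  | _, _, _ => None
  end.

Record model : Type := Model {
  dom : Type;
  pdom : Type;
  dom_inh : inhabited dom;
  funI : F -> dom -> dom;
  unI : P1 -> dom -> pdom;
  binI : P2 -> dom -> dom -> pdom;
  trueI : pdom }.

Section Semantics.
Variables (M : model) (mu : var -> dom M).

Fixpoint feval (t : fterm) : dom M :=
  match t with Var v => mu v | App f t => funI f (feval t) end.
Definition peval (A : pterm) : pdom M :=
  match A with
  | Un B t => unI B (feval t)
  | Bin R s t => binI R (feval s) (feval t)
  end.
Definition teval (s : term) : dom M + pdom M :=
  match s with
  | TF t => inl (feval t) | TP A => inr (peval A) | TTrue => inr (trueI M)
  end.

Definition sat_lit (L : literal) : Prop :=
  exists s t, L.2 = [mset s; t]%mset /\
    (if L.1 then teval s = teval t else teval s <> teval t).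
Definition sat_atoms (G : {fset pterm}) : Prop :=
  forall A, A \in G -> peval A = trueI M.
Definition sat_clause (C : clause) : Prop :=
  sat_atoms C.1 -> exists2 L, L \in C.2 & sat_lit L.
End Semantics.

(* O |= forall (all variables), Q *)
Definition entails (O : {fset clause})
    (Q : forall M : model, (var -> dom M) -> Prop) : Prop :=
  forall M : model,
    (forall C, C \in O -> forall mu, @sat_clause M mu C) ->
    forall mu, Q M mu.

Definition dl_body_atom (A : pterm) : bool :=
  match A with
  | Un _ (Var X) | Bin _ (Var X) (Var (Z _)) | Bin _ (Var (Z _)) (Var X) => true
  | _ => false
  end.

Definition dl_head_atom (A : pterm) : bool :=
  match A with
  | Un _ (Var (Z _)) | Un _ (Var X) | Un _ (App _ (Var X))
  | Bin _ (Var X) (Var (Z _)) | Bin _ (Var (Z _)) (Var X)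
  | Bin _ (Var X) (App _ (Var X)) | Bin _ (App _ (Var X)) (Var X) => true
  | _ => false
  end.

Inductive dl_literal : literal -> Prop :=
| DL_atom A : dl_head_atom A -> dl_literal (atom A)
| DL_ff b f g : dl_literal (lit b (TF (App f (Var X))) (TF (App g (Var X))))
| DL_fz b f i : dl_literal (lit b (TF (App f (Var X))) (TF (Var (Z i))))
| DL_zz b i j : dl_literal (lit b (TF (Var (Z i))) (TF (Var (Z j)))).

Definition dl_clause (C : clause) : Prop :=
  [/\ forall A, A \in C.1 -> dl_body_atom A,
      forall L, L \in C.2 -> dl_literal L &
      forall i L, L \in C.2 -> occurs_lit (Z i) L ->
        exists2 A, A \in C.1 & Z i \in pvars A].

Definition ontology (O : {fset clause}) : Prop :=
  forall C, C \in O -> dl_clause C.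

Definition context_fterm (t : fterm) : bool :=
  match t with Var X | Var Y | App _ (Var X) => true | _ => false end.
Definition context_pterm (A : pterm) : bool :=
  match A with
  | Un _ t => context_fterm t
  | Bin _ (Var X) (Var Y) | Bin _ (Var Y) (Var X)
  | Bin _ (Var X) (App _ (Var X)) | Bin _ (App _ (Var X)) (Var X) => true
  | _ => false
  end.
Definition context_term (s : term) : bool :=
  match s with
  | TF t => context_fterm t | TP A => context_pterm A | TTrue => false
  end.

Inductive context_literal : literal -> Prop :=
| Ctx_atom A : context_pterm A -> context_literal (atom A)
| Ctx_ff b f g :
    context_literal (lit b (TF (App f (Var X))) (TF (App g (Var X))))
| Ctx_fy b f : context_literal (lit b (TF (App f (Var X))) (TF (Var Y)))
| Ctx_yy b : context_literal (lit b (TF (Var Y)) (TF (Var Y))).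

Definition fun_free (A : pterm) : bool :=
  match A with
  | Un _ (Var _) | Bin _ (Var _) (Var _) => true
  | _ => false
  end.

Definition context_clause (C : clause) : Prop :=
  (forall A, A \in C.1 -> context_pterm A && fun_free A) /\
  (forall L, L \in C.2 -> context_literal L).

Definition trigger (A : pterm) : option pterm :=
  match A with
  | Un B (Var X) => Some (Un B (Var X))
  | Bin R (Var X) (Var (Z _)) => Some (Bin R (Var X) (Var Y))
  | Bin R (Var (Z _)) (Var X) => Some (Bin R (Var Y) (Var X))
  | _ => None
  end.

Definition Su (O : {fset clause}) : {fset pterm} :=
  \bigcup_(C <- O) [fset T in pmap trigger C.1].

Definition unary_occurs (B : P1) (O : {fset clause}) : Prop :=
  exists2 C, C \in O &
    exists t, Un B t \in C.1 \/ exists2 L, L \in C.2 & TP (Un B t) \in L.2.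

Inductive Pr (O : {fset clause}) : pterm -> Prop :=
| Pr_swap A : A \in Su O -> Pr O (psubst swap_xy A)
| Pr_unary B : unary_occurs B O -> Pr O (Un B (Var Y)).

Definition wf_total_order (gtF : rel F) : Prop :=
  [/\ irreflexive gtF, transitive gtF,
      forall f g, f != g -> gtF f g || gtF g f &
      well_founded (fun g f => gtF f g)].

(* A context term order is a relation on [term] that relates context terms
   only. *)
Record context_term_order (gtF : rel F) (O : {fset clause}) (gt : rel term) :
    Prop := ContextTermOrder {
  cto_dom : forall s t, gt s t -> context_term s && context_term t;
  cto_irr : irreflexive gt;
  cto_trans : transitive gt;
  cto_fxy : forall f, gt (TF (App f (Var X))) (TF (Var X)) /\
                      gt (TF (Var X)) (TF (Var Y));
  cto_fg : forall f g, gtF f g ->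
    gt (TF (App f (Var X))) (TF (App g (Var X)));
  (* restricted to replacements that yield context terms *)
  cto_mono : forall s1 s2 t p t1 t2, gt s1 s2 ->
    replace t p s1 = Some t1 -> replace t p s2 = Some t2 ->
    context_term t1 -> context_term t2 -> gt t1 t2;
  cto_sub : forall s p s', context_term s -> subterm s p = Some s' ->
    s' <> s -> gt s s';
  cto_Pr : forall A s, Pr O A -> context_term s ->
    s <> TF (Var X) -> s <> TF (Var Y) -> ~~ gt (TP A) s }.

Section LiteralOrder.
Variable gt : rel term.

Definition gt_true (s t : term) : bool :=
  match s, t with TP _, TTrue => true | _, _ => gt s t end.

Definition mset_gt (M N : {mset term}%mset) : Prop :=
  M <> N /\
  forall n, n \in (N `\` M)%mset -> exists2 m, m \in (M `\` N)%mset & gt_true m n.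

Definition lit_mset (L : literal) : {mset term}%mset :=
  if L.1 then L.2 else (L.2 `+` L.2)%mset.
Definition lit_gt (L1 L2 : literal) : Prop :=
  mset_gt (lit_mset L1) (lit_mset L2).
Definition not_ge (D : {fset literal}) (L : literal) : Prop :=
  forall L', L' \in D -> ~ (L' = L \/ lit_gt L' L).
End LiteralOrder.

(* containment up to redundancy *)
Definition redundant (C : clause) (U : {fset clause}) : Prop :=
  [\/ exists s s', eqlit s s' \in C.2 /\ neqlit s s' \in C.2,
      exists s, eqlit s s \in C.2 |
      exists2 C', C' \in U & (C'.1 `<=` C.1) && (C'.2 `<=` C.2)].

Definition top_clause (A : pterm) : clause := (fset0, [fset atom A]).
Definition taut_clause (A : pterm) : clause := ([fset A], [fset atom A]).

End Syntax.

Section Structures.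
Variables (P1 P2 F W : countType).
Notation pterm := (pterm P1 P2 F).
Notation term := (term P1 P2 F).
Notation literal := (literal P1 P2 F).
Notation clause := (clause P1 P2 F).

Record context : Type := Context {
  core : {fset pterm};
  clauses : {fset clause};
  order : rel term }.

(* Contexts are named by elements of [W]; the set V of contexts is the domain
   of the finite map [contexts]. *)
Record cstruct : Type := CStruct {
  contexts : {fmap W -> context};
  edges : {fset W * W * F} }.

Variables (gtF : rel F) (O : {fset clause}).

Definition context_structure (D : cstruct) : Prop :=
  (forall u v f, (u, v, f) \in edges D ->
     (u \in contexts D) && (v \in contexts D)) /\
  (forall v c, (contexts D).[? v] = Some c ->
     [/\ core c `<=` Su O,
         forall C, C \in clauses c -> context_clause C &
         context_term_order gtF O (order c)]).

Definition sound (D : cstruct) : Prop :=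
  (forall v c C, (contexts D).[? v] = Some c -> C \in clauses c ->
     entails O (fun M mu => @sat_clause P1 P2 F M mu (core c `|` C.1, C.2))) /\
  (forall u v f cu cv, (u, v, f) \in edges D ->
     (contexts D).[? u] = Some cu -> (contexts D).[? v] = Some cv ->
     entails O (fun M mu => @sat_atoms P1 P2 F M mu (core cu) ->
       sat_atoms mu [fset psubst (sigma f) A | A in core cv])).

(* Polynomial time, by Turing machines with a two-way infinite tape over
   {0, 1, blank}; [None] is the blank. *)
Record machine : Type := Machine {
  state : finType;
  start : state;
  (* new state, written symbol, move right?; [None] halts *)
  delta : state -> option bool -> option (state * option bool * bool) }.

(* state, tape left of the head (nearest cell first), tape from the head on *)
Definition config (T : machine) : Type :=
  (state T * seq (option bool) * seq (option bool))%type.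

Definition mstep (T : machine) (c : config T) : option (config T) :=
  let: (q, l, r) := c in
  omap (fun a : state T * option bool * bool =>
          let: (q', b, to_right) := a in
          if to_right then (q', b :: l, behead r)
          else (q', behead l, head None l :: b :: behead r))
       (delta q (head None r)).

Definition tape_output (r : seq (option bool)) : seq bool :=
  pmap id (take (index None r) r).

Fixpoint run (T : machine) (n : nat) (c : config T) : option (seq bool) :=
  match mstep c, n with
  | None, _ => Some (tape_output c.2)
  | Some c', n'.+1 => run n' c'
  | Some _, 0 => None
  end.

Definition machine_output (T : machine) (n : nat) (w : seq bool) :=
  run n ((start T, [::], [seq Some b | b <- w]) : config T).

Definition strategy_type : Type :=
  F -> {fset pterm} -> cstruct -> W * {fset pterm} * rel term.

(* Bit-string encodings of the arguments and results of a strategy.  They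
   represent all finite data faithfully.  Term orders are in general infinite
   objects, and no particular finite presentation of them is imposed; a result
   may be encoded relative to the arguments (for example, its order restricted
   to the symbols occurring there). *)
Record encoding : Type := Encoding {
  enc_in : F -> {fset pterm} -> cstruct -> seq bool;
  enc_out : F -> {fset pterm} -> cstruct ->
            W * {fset pterm} * rel term -> seq bool;
  enc_in_inj : forall f K D f' K' D', enc_in f K D = enc_in f' K' D' ->
    [/\ f = f', K = K', edges D = edges D' &
        forall v, omap (fun c => (core c, clauses c)) (contexts D).[? v] =
                  omap (fun c => (core c, clauses c)) (contexts D').[? v]];
  enc_out_inj : forall f K D r r', enc_out f K D r = enc_out f K D r' ->
    r.1 = r'.1 }.

Definition polytime (enc : encoding) (strat : strategy_type) : Prop :=
  exists (T : machine) (a k : nat), forall f K D, context_structure D ->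
    let w := enc_in enc f K D in
    machine_output T (a * (size w).+1 ^ k) w =
      Some (enc_out enc f K D (strat f K D)).

Definition expansion_strategy (enc : encoding) (strat : strategy_type) : Prop :=
  polytime enc strat /\
  forall f K D, context_structure D ->
    let: (v, core', gt') := strat f K D in
    [/\ core' `<=` K, context_term_order gtF O gt' &
        match (contexts D).[? v] with
        | None => True
        | Some c => core c = core'
        end].

Definition set_clauses (D : cstruct) (v : W) (c : context) (U : {fset clause}) :
    cstruct :=
  CStruct (contexts D).[v <- Context (core c) U (order c)] (edges D).
Definition add_clause (D : cstruct) (v : W) (c : context) (C : clause) :
    cstruct :=
  set_clauses D v c (C |` clauses c).

Definition K1 (f : F) (U : {fset clause}) : {fset pterm} :=
  [fset A in Su O | top_clause (psubst (sigma f) A) \in U].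
Definition K2 (f : F) (c : context) : {fset pterm} :=
  [fset A in Su O | `[< exists G D,
     (G, atom (psubst (sigma f) A) |` D) \in clauses c /\
     not_ge (order c) D (atom (psubst (sigma f) A)) >]].

(* [step strat D D'] : a rule applied to [O] and [D] yields [D'].  Below, [G],
   [H] are bodies and heads; [Hd] is the head of an ontology clause. *)
Inductive step (strat : strategy_type) (D : cstruct) : cstruct -> Prop :=
| Rule_core v c A :
    (contexts D).[? v] = Some c ->
    A \in core c -> top_clause A \notin clauses c ->
    step strat D (add_clause D v c (top_clause A))

| Rule_hyper v c n (A : 'I_n -> pterm) Hd (sg : subst F)
        (G : 'I_n -> {fset pterm}) (H : 'I_n -> {fset literal}) :
    (contexts D).[? v] = Some c ->
    ([fset A i | i : 'I_n], Hd) \in O ->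
    sg X = Var F X ->
    (forall i, (G i, atom (psubst sg (A i)) |` H i) \in clauses c) ->
    (forall i, not_ge (order c) (H i) (atom (psubst sg (A i)))) ->
    let C : clause :=
      (\bigcup_(i in 'I_n) G i,
       [fset lsubst sg L | L in Hd] `|` \bigcup_(i in 'I_n) H i) in
    ~ redundant C (clauses c) ->
    step strat D (add_clause D v c C)

| Rule_eq v c G1 H1 s1 t1 G2 H2 b s2 t2 p s2' :
    (contexts D).[? v] = Some c ->
    (G1, eqlit s1 t1 |` H1) \in clauses c ->
    gt_true (order c) s1 t1 -> not_ge (order c) H1 (eqlit s1 t1) ->
    (G2, lit b s2 t2 |` H2) \in clauses c ->
    gt_true (order c) s2 t2 -> not_ge (order c) H2 (lit b s2 t2) ->
    subterm s2 p = Some s1 -> replace s2 p t1 = Some s2' ->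
    let C : clause := (G1 `|` G2, H1 `|` H2 `|` [fset lit b s2' t2]) in
    ~ redundant C (clauses c) ->
    step strat D (add_clause D v c C)

| Rule_ineq v c G H t :
    (contexts D).[? v] = Some c ->
    (G, neqlit t t |` H) \in clauses c ->
    ~ redundant (G, H) (clauses c) ->
    step strat D (add_clause D v c (G, H))

| Rule_factor v c G H s t t' :
    (contexts D).[? v] = Some c ->
    (G, H `|` [fset eqlit s t; eqlit s t']) \in clauses c ->
    not_ge (order c) (eqlit s t |` H) (eqlit s t') ->
    gt_true (order c) s t' ->
    let C : clause := (G, H `|` [fset neqlit t t'; eqlit s t']) in
    ~ redundant C (clauses c) ->
    step strat D (add_clause D v c C)

| Rule_elim v c C :
    (contexts D).[? v] = Some c ->
    C \in clauses c -> redundant C (clauses c `\ C) ->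
    step strat D (set_clauses D v c (clauses c `\ C))

| Rule_pred u v f cu cv l n (A : 'I_l -> pterm) (A' : 'I_n -> pterm)
       (G : 'I_l -> {fset pterm}) (H : 'I_l -> {fset literal}) :
    (u, v, f) \in edges D ->
    (contexts D).[? u] = Some cu -> (contexts D).[? v] = Some cv ->
    ([fset A i | i : 'I_l], [fset atom (A' j) | j : 'I_n]) \in clauses cv ->
    (forall i, (G i, atom (psubst (sigma f) (A i)) |` H i) \in clauses cu) ->
    (forall i, not_ge (order cu) (H i) (atom (psubst (sigma f) (A i)))) ->
    (forall j, Pr O (A' j)) ->
    let C : clause :=
      (\bigcup_(i in 'I_l) G i,
       \bigcup_(i in 'I_l) H i `|`
         [fset atom (psubst (sigma f) (A' j)) | j : 'I_n]) in
    ~ redundant C (clauses cu) ->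
    step strat D (add_clause D u cu C)

| Rule_succ u cu f G H A p v core' gt' :
    (contexts D).[? u] = Some cu ->
    (G, atom A |` H) \in clauses cu -> not_ge (order cu) H (atom A) ->
    subterm (TP A) p = Some (TF P1 P2 (App f (Var F X))) ->
    ~ (exists w cw, [/\ (u, w, f) \in edges D,
         (contexts D).[? w] = Some cw &
         forall A', A' \in K2 f cu `\` core cw ->
           redundant (taut_clause A') (clauses cw)]) ->
    strat f (K1 f (clauses cu)) D = (v, core', gt') ->
    let cv := match (contexts D).[? v] with
              | Some c => Context (core c) (clauses c)
                            (fun s t => order c s t && gt' s t)
              | None => Context core' fset0 gt'
              end in
    let cv' := Context (core cv)
                 (clauses cv `|`
                    [fset taut_clause A' | A' in K2 f cu `\` core cv])
                 (order cv) in
    step strat D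
      (CStruct (contexts D).[v <- cv'] ((u, v, f) |` edges D)).

End Structures.

(* Main.v *)
(* Each rule is semantically sound by resolution and congruence, with Hyper and
   Pred evaluating the instantiated clause under the valuation [mu \o sg].  The
   conclusions stay within context clauses because a substitution making a body
   atom S(x,z_i) or S(z_i,x) a context atom must send z_i to y or to some f(x),
   and because y is minimal among y and the f(x), so that Eq and Factor act on a
   maximal side f(x) or an atom.  The only ill-formed conclusions, with [true] on
   both sides of a literal, are redundant, hence never added.  For Succ, the
   conjunction of two context term orders is again one, and the new edge is
   sound since its core consists of consequences of the core of its source. *)

Require Import Defs.
From mathcomp Require Import all_boot.
From mathcomp Require Import finmap.
From mathcomp Require Import multiset boolp.

Set Implicit Arguments.
Unset Strict Implicit.
Unset Printing Implicit Defensive.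

Local Open Scope fmap_scope.
Local Open Scope fset_scope.

(** * Literals as two-element multisets *)

Lemma mset2_inj (K : choiceType) (a b c d : K) :
  [mset a; b]%mset = [mset c; d]%mset ->
  (a = c /\ b = d) \/ (a = d /\ b = c).
Proof.
have msetD1_inj (x y z : K) : [mset x; y]%mset = [mset x; z]%mset -> y = z.
  move=> /(congr1 (fun A => msetB A [mset x]%mset)); rewrite !msetD1K.
  by move=> /(congr1 (fun A => y \in A)); rewrite !in_mset1 eqxx => /esym/eqP.
move=> e; have := mset21 a b; rewrite e in_mset2 => /orP[] /eqP ac.
  by left; split=> //; apply: (msetD1_inj c); rewrite -e ac.
by right; split=> //; apply: (msetD1_inj d); rewrite [RHS]msetDC -e ac.
Qed.

Section Literals.
Variables P1 P2 F : countType.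
Implicit Types (s t : term P1 P2 F) (A : pterm P1 P2 F) (u : fterm F).
Implicit Types (O : {fset clause P1 P2 F}) (sg : subst F).

(** The variable [y] stands for the predecessor of [x] and f(x) for a successor; [x] itself is never
    a side of a context literal. *)
Definition successor_or_pred u : bool :=
  match u with Var Y | App _ (Var X) => true | _ => false end.

(** A computable form of [context_literal] for two sides given in some order, so that case analysis
    on the sides decides it. Symmetry accounts for both orientations of an atom, and [b] for atoms
    being positive. *)
Definition context_sides (b : bool) s t : bool :=
  match s, t with
  | TP A, TTrue | TTrue, TP A => b && context_pterm A
  | TF u, TF v => successor_or_pred u && successor_or_pred v
  | _, _ => false
  end.

Lemma litC b s t : lit b s t = lit b t s.
Proof. by rewrite /lit msetDC. Qed.

Lemma lit_inj b s t b' s' t' : lit b s t = lit b' s' t' ->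
  b = b' /\ ((s = s' /\ t = t') \/ (s = t' /\ t = s')).
Proof. by case=> -> /mset2_inj. Qed.

Lemma context_literalP b s t :
  reflect (context_literal (lit b s t)) (context_sides b s t).
Proof.
apply: (iffP idP).
  case: s t => [u|A|] [v|B|] //=.
  - case: u => [[||?]|f [[||?]|? ?]] //; case: v => [[||?]|g [[||?]|? ?]] //= _.
    + exact: Ctx_yy.
    + rewrite litC; exact: Ctx_fy.
    + exact: Ctx_fy.
    + exact: Ctx_ff.
  - by case: b => //= cA; exact: Ctx_atom.
  - by case: b => //= cA; rewrite litC; exact: Ctx_atom.
move E: (lit b s t) => L cL.
by case: cL E => [A cA|b' f g|b' f|b'] /lit_inj[-> [] [-> ->]].
Qed.

Lemma context_atomE A : context_literal (atom A) -> context_pterm A.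
Proof. by move/context_literalP. Qed.

Lemma lsubst_lit sg b s t :
  lsubst sg (lit b s t) = lit b (tsubst sg s) (tsubst sg t).
Proof.
rewrite /lsubst /lit /=; congr pair; apply/msetP => x.
rewrite mset_seqE.
(* [lsubst] enumerates the multiset in an unspecified order; only multiplicities matter, so the
   enumeration may be replaced by [s, t]. *)
have /(perm_map (tsubst sg))/permP-> : perm_eq [mset s; t]%mset [:: s; t].
  apply/allP => y _ /=; rewrite count_mem_mset mset1DE msetnE.
  by rewrite addn0 [s == y]eq_sym [t == y]eq_sym; case: (y == t).
rewrite mset1DE msetnE /= addn0 [_ s == x]eq_sym [_ t == x]eq_sym.
by case: (x == tsubst sg t).
Qed.

Lemma lsubst_atom sg A : lsubst sg (atom A) = atom (psubst sg A).
Proof. exact: lsubst_lit. Qed.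

End Literals.

(** * Semantics of substitution, replacement and resolution *)

Section Semantics.
Variables (P1 P2 F : countType) (M : model P1 P2 F).
Implicit Types (mu : var -> dom M) (s t : term P1 P2 F) (A : pterm P1 P2 F).

(** [sat_lit] picks some ordering of the two sides; equality and disequality are symmetric, so any
    ordering will do. *)
Lemma sat_litE mu b s t :
  sat_lit mu (lit b s t) <->
  if b then teval mu s = teval mu t else teval mu s <> teval mu t.
Proof.
split=> [[s' [t' [/= /mset2_inj[] [-> ->]]]]|h]; last by exists s, t.
  by [].
by case: b => [->|ne /esym].
Qed.

Lemma sat_atomE mu A : sat_lit mu (atom A) <-> peval mu A = trueI M.
Proof. by rewrite /atom sat_litE /=; split=> [[]|->]. Qed.

Lemma feval_subst mu sg u : feval mu (fsubst sg u) = feval (feval mu \o sg) u.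
Proof. by elim: u => //= f u ->. Qed.

Lemma peval_subst mu sg A : peval mu (psubst sg A) = peval (feval mu \o sg) A.
Proof. by case: A => *; rewrite /= !feval_subst. Qed.

Lemma teval_subst mu sg s : teval mu (tsubst sg s) = teval (feval mu \o sg) s.
Proof. by case: s => // *; rewrite /= ?feval_subst ?peval_subst. Qed.

Lemma sat_lit_subst mu sg L :
  sat_lit (feval mu \o sg) L -> sat_lit mu (lsubst sg L).
Proof.
case: L => b m [s [t [/= -> h]]]; rewrite -/(lit b s t) lsubst_lit sat_litE.
by rewrite !teval_subst.
Qed.

Lemma fsubterm_feval mu (u u' v w : fterm F) p : fsubterm u p = Some v ->
  freplace u p w = Some u' -> feval mu v = feval mu w ->
  feval mu u = feval mu u'.
Proof.
elim: p u u' => [|[|[|?]] p IH] [x|f u] u' //=.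
- by move=> [<-] [<-].
- by move=> [<-] [<-].
- case E: freplace => [u1|] //= sp [<-] e.
  by rewrite /= (IH _ _ sp E e).
Qed.

(** Congruence, the semantic content of Eq: evaluation is compositional, so equals may be replaced
    at any position. *)
Lemma subterm_teval mu s p s1 t1 s' : subterm s p = Some s1 ->
  replace s p t1 = Some s' -> teval mu s1 = teval mu t1 ->
  teval mu s = teval mu s'.
Proof.
case: p => [|n p]; first by case: s => [?|?|] /= [<-] [<-].
case: n => [|[|[|n]]]; case: s => [u|[B u|R u v]|] //;
  rewrite /subterm /replace;
  case Es: fsubterm => [w|] // [<-];
  case: t1 => // t1; case Er: freplace => [w'|] // [<-] [e];
  by rewrite /= (fsubterm_feval Es Er e).
Qed.

Lemma sat_atomsU mu (G1 G2 : {fset pterm P1 P2 F}) :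
  sat_atoms mu (G1 `|` G2) <-> sat_atoms mu G1 /\ sat_atoms mu G2.
Proof.
split=> [h|[h1 h2] A /fsetUP[/h1|/h2] //].
by split=> A AG; apply: h; rewrite inE AG ?orbT.
Qed.

Lemma sat_atoms_subst mu sg (K : {fset pterm P1 P2 F}) :
  sat_atoms mu [fset psubst sg A | A in K] <-> sat_atoms (feval mu \o sg) K.
Proof.
split=> h A; first by move=> AK; rewrite -peval_subst; apply/h/in_imfset.
by case/imfsetP => B /= BK ->; rewrite peval_subst; apply: h.
Qed.

(* The common core of Hyper ([K'] empty, main premise in [O]) and of Pred
   ([K'] the core of the target of the edge, main premise in its clauses). *)
Lemma hyperresolution_sound mu sg (K K' : {fset pterm P1 P2 F}) l
    (A : 'I_l -> pterm P1 P2 F) G H Hd :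
  (forall i, sat_clause mu (K `|` G i, atom (psubst sg (A i)) |` H i)) ->
  sat_clause (feval mu \o sg) (K' `|` [fset A i | i : 'I_l], Hd) ->
  (sat_atoms mu K -> sat_atoms (feval mu \o sg) K') ->
  sat_clause mu (K `|` \bigcup_(i in 'I_l) G i,
    [fset lsubst sg L | L in Hd] `|` \bigcup_(i in 'I_l) H i).
Proof.
move=> prem main core /sat_atomsU[sK sG].
(* A true side literal of a premise already satisfies the conclusion. Otherwise every premise yields
   its resolved atom, and the main premise fires under the composed valuation. *)
have [[i [L LH sL]]|none] :=
    pselect (exists i, exists2 L, L \in H i & sat_lit mu L).
  exists L => //; rewrite inE; apply/orP; right.
  by apply/bigfcupP; exists i; rewrite ?mem_index_enum.
case: main => [|L LHd sL]; last first.
  exists (lsubst sg L); last exact: sat_lit_subst.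
  by rewrite inE in_imfset.
apply/sat_atomsU; split=> [|B /imfsetP[i _ ->]]; first exact: core.
rewrite -peval_subst; case: (prem i) => [|L /fset1UP[->|LH] sL].
- apply/sat_atomsU; split=> // B' BG; apply: sG.
  by apply/bigfcupP; exists i; rewrite ?mem_index_enum.
- exact/sat_atomE.
- by case: none; exists i, L.
Qed.

End Semantics.

(** * Shape of triggers, orders and instantiated DL-clauses *)

Section ContextClauses.
Variables (P1 P2 F : countType) (gtF : rel F) (O : {fset clause P1 P2 F}).
Implicit Types (s t : term P1 P2 F) (A : pterm P1 P2 F) (u : fterm F).

Lemma Su_shape A : A \in Su O ->
  [\/ exists B, A = Un P2 B (Var F X),
      exists R, A = Bin P1 R (Var F X) (Var F Y) |
      exists R, A = Bin P1 R (Var F Y) (Var F X)].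
Proof.
case/bigfcupP=> C _; rewrite !inE mem_pmap => /mapP[B _].
case: B => [B|R] [[||i]|f t] //=.
- by case=> ->; constructor 1; exists B.
- by case=> [[||j]|g t] //= [->]; constructor 2; exists R.
- by case=> [[||j]|g t] //= [->]; constructor 3; exists R.
Qed.

Lemma Su_context A : A \in Su O -> context_pterm A && fun_free A.
Proof. by case/Su_shape=> [] [B ->]. Qed.

(** The atoms B(y), S(y,x) and S(x,y) become B(x), S(x,f(x)) and S(f(x),x). *)
Lemma Pr_sigma_context f A : Pr O A -> context_pterm (psubst (sigma f) A).
Proof. by case=> [B /Su_shape[] [R ->]|B _]. Qed.

(** The required comparisons and the closure conditions hold in both relations, hence in the
    intersection; the prohibitions pass to any smaller relation. *)
Lemma context_term_orderI gt gt' :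
  context_term_order gtF O gt -> context_term_order gtF O gt' ->
  context_term_order gtF O (fun s t => gt s t && gt' s t).
Proof.
move=> h h'; split=> [s t|s|t s r|f|f g fg|s1 s2 t p t1 t2|s p s' cs sp ne
                  |A s prA cs nx ny].
- by case/andP=> /(cto_dom h).
- by rewrite (cto_irr h).
- by case/andP=> st st' /andP[tr tr']; rewrite (cto_trans h st tr)
    (cto_trans h' st').
- have [-> ->] := cto_fxy h f; have [-> ->] := cto_fxy h' f; by [].
- by rewrite (cto_fg h fg) (cto_fg h' fg).
- case/andP=> g g' r1 r2 c1 c2.
  by rewrite (cto_mono h g r1 r2 c1 c2) (cto_mono h' g' r1 r2 c1 c2).
- by rewrite (cto_sub h cs sp ne) (cto_sub h' cs sp ne).
- by rewrite negb_and (cto_Pr h prA cs nx ny).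
Qed.

Lemma dl_head_context sg (C : clause P1 P2 F) L :
  dl_clause C -> sg X = Var F X ->
  (forall A, A \in C.1 -> context_pterm (psubst sg A)) ->
  L \in C.2 -> context_literal (lsubst sg L).
Proof.
case=> dlb dlh safe sgX cbody LC.
(* A head variable z_i also occurs in the body, in some S(x,z_i) or S(z_i,x), and the instance of
   that atom is a context atom. *)
have sgZ i : occurs_lit (Z i) L -> successor_or_pred (sg (Z i)).
  move=> /(safe _ _ LC)[A AB]; move: (dlb _ AB) (cbody _ AB).
  case: A {AB} => [B|R] [[||j]|f t] //=.
  - by case=> [[||j]|g t] //= _; rewrite sgX !inE => + /eqP[->].
  - case=> [[||k]|g t] //= _; rewrite sgX !inE orbF => + /eqP[->].
    by case: (sg _) => [[]|? [[]|]].
case: (dlh _ LC) sgZ => {LC} [A dA|b f g|b f i|b i j] sgZ;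
  rewrite lsubst_lit; apply/context_literalP.
- have sgA i : Z i \in pvars A -> successor_or_pred (sg (Z i)).
    by move=> iA; apply: sgZ; exists (TP A); rewrite ?mset21.
  case: A dA sgA {sgZ} => [B|R].
    case=> [[||i]|f [[||i]|f' t]] //= _ sgA; rewrite ?sgX //.
    by move: (sgA i (mem_head _ _)); case: (sg _) => [[]|? [[]|]].
  case=> [[||i]|f [[||i]|f' t]] //;
    case=> [[||j]|g [[||j]|g' v]] //= _ sgA; rewrite ?sgX //.
    by move: (sgA j); rewrite !inE eqxx => /(_ isT);
      case: (sg _) => [[]|? [[]|]].
  by move: (sgA i); rewrite !inE eqxx => /(_ isT); case: (sg _) => [[]|? [[]|]].
- by rewrite /= sgX.
- rewrite /= sgX; apply: sgZ.
  by exists (TF _ _ (Var F (Z i))); rewrite ?mset22 /= ?mem_head.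
- apply/andP; split; apply: sgZ.
    by exists (TF _ _ (Var F (Z i))); rewrite ?mset21 /= ?mem_head.
  by exists (TF _ _ (Var F (Z j))); rewrite ?mset22 /= ?mem_head.
Qed.

(** * Rewriting under a context term order *)

Section Order.
Variable gt : rel (term P1 P2 F).
Hypothesis gtO : context_term_order gtF O gt.

Lemma gt_true_true t : gt_true gt (TTrue P1 P2 F) t = false.
Proof. by apply/negP=> /(cto_dom gtO). Qed.

Lemma gt_y_context u : successor_or_pred u ->
  gt (TF P1 P2 (Var F Y)) (TF P1 P2 u) = false.
Proof.
case: u => [[||i]|f [[||i]|g t]] // _; first exact: cto_irr gtO _.
have [fx xy] := cto_fxy gtO f; apply/negP=> yf.
(* The cycle f(x), x, y, f(x) would contradict irreflexivity. *)
by move: (cto_trans gtO (cto_trans gtO fx xy) yf); rewrite (cto_irr gtO).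
Qed.

(** Neither [true] nor [y] can be the larger side; this leaves an atom against [true], or some f(x)
    against [y] or a successor. *)
Lemma gt_true_context b s t : context_sides b s t -> gt_true gt s t ->
  match s, t with
  | TP A, TTrue => b && context_pterm A
  | TF (App _ (Var X)), TF v => successor_or_pred v
  | _, _ => false
  end.
Proof.
case: s => [u|A|]; last by rewrite gt_true_true.
  case: t => //= v /andP[+ cv]; case: u => [[||i]|f [[||i]|? ?]] //.
  by rewrite gt_y_context.
by case: t.
Qed.

(** A context F-term contains at most one function symbol, so f(x) can only occur at its root. *)
Lemma fsubterm_context f u v u' p : context_fterm u ->
  fsubterm u p = Some (App f (Var F X)) -> freplace u p v = Some u' ->
  u = App f (Var F X) /\ u' = v.
Proof.
case: p => [|[|[|n]] p]; first by case: u => [x|g u] _ //= [-> ->] [->].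
- by case: u => [].
- by case: u => // g [[||?]|? ?] //= _; case: p => [|[|[|?]] ?].
- by case: u => [].
Qed.

(** The replaced f(x) is an entire argument of the atom. In a binary context atom the other argument
    is then [x], which admits both [y] and g(x) as partner. *)
Lemma pterm_replace_context f A v p s' : context_pterm A ->
  successor_or_pred v ->
  subterm (TP A) p = Some (TF P1 P2 (App f (Var F X))) ->
  replace (TP A) p (TF P1 P2 v) = Some s' ->
  exists2 B, s' = TP B & context_pterm B.
Proof.
case: p => [|n p] // cA cv; case: A cA => [B u|R u w].
  case: n => [|[|[|n]]] //= cu; case Es: fsubterm => [u1|] // [eu].
  case Er: freplace => [u2|] //= [<-]; rewrite eu in Es.
  have [_ ->] := fsubterm_context cu Es Er; exists (Un P2 B v) => //.
  by case: (v) cv => [[||?]|? [[||?]|? ?]].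
move=> cA; have /andP[cu cw] : context_fterm u && context_fterm w.
  by case: u w cA => [[||?]|? [[||?]|? ?]] [[||?]|? [[||?]|? ?]].
case: n => [|[|[|n]]] //=; case Es: fsubterm => [u1|] // [eu];
  case Er: freplace => [u2|] //= [<-]; rewrite eu in Es.
- have [ue ->] := fsubterm_context cu Es Er; rewrite ue in cA.
  exists (Bin P1 R v w) => //.
  by case: w cA {cw} => [[||?]|? [[||?]|? ?]].
- have [we ->] := fsubterm_context cw Es Er; rewrite we in cA.
  exists (Bin P1 R u v) => //.
  by case: u cA {cu} => [[||?]|? [[||?]|? ?]].
Qed.

Lemma replace_context b s1 t1 s2 t2 p s2' :
  context_sides true s1 t1 -> gt_true gt s1 t1 ->
  context_sides b s2 t2 -> gt_true gt s2 t2 ->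
  subterm s2 p = Some s1 -> replace s2 p t1 = Some s2' ->
  context_sides b s2' t2 \/ b /\ s2' = t2.
Proof.
move=> c1 g1 c2 g2; move: (gt_true_context c1 g1) (gt_true_context c2 g2).
case: s1 {c1 g1} => [[|f [[||?]|? ?]]|A|] //; case: t1 => //.
  move=> v cv; case: s2 {g2} c2 => [u|B|] //; case: t2 => //.
    move=> w /andP[cu cw] _ Es Er; left.
    have cu' : context_fterm u by case: u cu {Es Er} => [[||?]|? [[||?]|? ?]].
    case: p Es Er => [|n p]; first by move=> _ [<-]; rewrite /= cv.
    case: n => [|[|[|n]]]; rewrite /subterm /replace;
    case Es: fsubterm => [u1|] // [eu]; case Er: freplace => [u2|] // [<-];
    rewrite eu in Es;
    by have [_ ->] := fsubterm_context cu' Es Er; rewrite /= cv.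
  move=> /andP[bT cB] _ Es Er; left.
  by have [B' -> cB'] := pterm_replace_context cB cv Es Er; rewrite /= bT.
case: s2 {g2} c2 => [u|B|] //; case: t2 => //.
  by move=> w _ cA cw; case: p => [|[|[|[|n]]] p] //;
    rewrite /subterm; case: fsubterm.
(* A P-term occurs only at the root, so rewriting with an atom turns the whole side into [true]. *)
case: p => [|n p] /andP[bT _] _ _; first by move=> _ [<-]; right.
by case: B => [B u|R u v]; case: n => [|[|[|?]]] //=; case: fsubterm.
Qed.

(** If [s] is some f(x), both [t] and [t'] are [y] or successors; if [s] is an atom, both are
    [true]. *)
Lemma factor_context s t t' :
  context_sides true s t -> context_sides true s t' -> gt_true gt s t' ->
  context_sides false t t' \/ t = t'.
Proof.
move=> c c' g; move: (gt_true_context c' g).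
case: s {c' g} c => [[|f [[||?]|? ?]]|A|] //; case: t' => //.
  by move=> v; case: t => //= u cu cv; left; rewrite cu.
by case: t => // _ _; right.
Qed.

End Order.
End ContextClauses.

(** * Soundness of each inference rule *)

Section Preservation.
Variables (P1 P2 F W : countType) (gtF : rel F) (O : {fset clause P1 P2 F}).
Implicit Types (D : cstruct P1 P2 F W) (C : clause P1 P2 F).

Definition entails_clause (K : {fset pterm P1 P2 F}) C :=
  entails O (fun M mu => @sat_clause P1 P2 F M mu (K `|` C.1, C.2)).

Definition sound_structure D := context_structure gtF O D /\ sound O D.

(** Cores, orders and edges stay as they are, so (S2) carries over and only the clauses of [U] that
    are new at [v] need checking. *)
Lemma set_clauses_sound D v c U :
  sound_structure D -> (contexts D).[? v] = Some c ->
  (forall C, C \in U -> C \in clauses c \/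
     (context_clause C /\ entails_clause (core c) C)) ->
  sound_structure (set_clauses D v c U).
Proof.
case=> [[edgeD ctxD] [S1 S2]] vc hU.
have [coreS clauseC orderC] := ctxD _ _ vc.
have coreE w cw : (set_clauses D v c U).(contexts).[? w] = Some cw ->
    exists2 cw', (contexts D).[? w] = Some cw' & core cw = core cw'.
  rewrite fnd_set; case: eqP => [-> [<-]|_ wc]; first by exists c.
  by exists cw.
split; split.
- by move=> u w f /edgeD/andP[uD wD]; rewrite /= !inE uD wD !orbT.
- move=> w cw /=; rewrite fnd_set; case: eqP => [_ [<-]|_ /ctxD //].
  by split=> //= C /hU[/clauseC|[]].
- move=> w cw C /=; rewrite fnd_set; case: eqP => [_ [<-]|_ /S1]; last exact.
  by move=> /hU[/(S1 _ _ _ vc)|[]].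
- move=> u w f cu cw uw /coreE[cu' uD ->] /coreE[cw' wD ->].
  exact: S2 uw uD wD.
Qed.

Lemma add_clause_sound D v c C :
  sound_structure D -> (contexts D).[? v] = Some c ->
  context_clause C -> entails_clause (core c) C ->
  sound_structure (add_clause D v c C).
Proof.
move=> sD vc cC eC; apply: set_clauses_sound => // C'.
by case/fset1UP=> [->|]; [right|left].
Qed.

Section Context.
Variables (D : cstruct P1 P2 F W) (v : W) (c : context P1 P2 F).
Hypotheses (sD : sound_structure D) (vc : (contexts D).[? v] = Some c).

Let S1 C : C \in clauses c -> entails_clause (core c) C.
Proof. by have [_ [h _]] := sD; apply: h vc. Qed.

Let clauseC C : C \in clauses c -> context_clause C.
Proof. by have [[_ h] _] := sD; case: (h _ _ vc) => _ + _; apply. Qed.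

Let orderC : context_term_order gtF O (Defs.order c).
Proof. by have [[_ h] _] := sD; case: (h _ _ vc). Qed.

Lemma core_sound A :
  A \in core c -> sound_structure (add_clause D v c (top_clause A)).
Proof.
move=> Ac; apply: add_clause_sound => //; first split=> [B|L].
- by rewrite inE.
- rewrite inE => /eqP ->; apply: Ctx_atom.
  have [[_ h] _] := sD; case: (h _ _ vc) => /fsubsetP/(_ _ Ac)/Su_context.
  by case/andP.
move=> M _ mu /sat_atomsU[sc _]; exists (atom A); rewrite ?inE //.
exact/sat_atomE/sc.
Qed.

Lemma hyper_sound n (A : 'I_n -> pterm P1 P2 F) Hd sg
    (G : 'I_n -> {fset pterm P1 P2 F}) (H : 'I_n -> {fset literal P1 P2 F}) :
  ontology O -> ([fset A i | i : 'I_n], Hd) \in O -> sg X = Var F X ->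
  (forall i, (G i, atom (psubst sg (A i)) |` H i) \in clauses c) ->
  sound_structure (add_clause D v c (\bigcup_(i in 'I_n) G i,
    [fset lsubst sg L | L in Hd] `|` \bigcup_(i in 'I_n) H i)).
Proof.
move=> ontO inO sgX prem; apply: add_clause_sound => //; first split=> [B|L] /=.
- case/bigfcupP=> i _ BG; have [h _] := clauseC (prem i); exact: h.
- case/fsetUP=> [/imfsetP[L' /= LHd ->]|/bigfcupP[i _ LH]]; last first.
    by have [_ h] := clauseC (prem i); apply: h; rewrite inE LH orbT.
  apply: (dl_head_context (ontO _ inO)) => // B /imfsetP[i _ ->].
  by have [_ h] := clauseC (prem i); apply/context_atomE/h; rewrite fset1U1.
move=> M MO mu; apply: (@hyperresolution_sound _ _ _ M mu sg _ fset0 n A) => //.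
- by move=> i; apply: S1 (prem i) M MO mu.
- by rewrite fset0U; apply: MO.
Qed.

Lemma eq_sound G1 H1 s1 t1 G2 H2 b s2 t2 p s2' :
  (G1, eqlit s1 t1 |` H1) \in clauses c -> gt_true (Defs.order c) s1 t1 ->
  (G2, lit b s2 t2 |` H2) \in clauses c -> gt_true (Defs.order c) s2 t2 ->
  subterm s2 p = Some s1 -> replace s2 p t1 = Some s2' ->
  let C := (G1 `|` G2, H1 `|` H2 `|` [fset lit b s2' t2]) in
  ~ redundant C (clauses c) -> sound_structure (add_clause D v c C).
Proof.
move=> in1 gt1 in2 gt2 sub rep C nred.
have [[cG1 cH1] [cG2 cH2]] := (clauseC in1, clauseC in2).
apply: add_clause_sound => //; first split=> [A|L] /=.
- by case/fsetUP=> [/cG1|/cG2].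
- case/fsetUP=> [/fsetUP[LH|LH]|/fset1P->].
  + by apply: cH1; rewrite inE LH orbT.
  + by apply: cH2; rewrite inE LH orbT.
  apply/context_literalP.
  have /context_literalP c1 := cH1 _ (fset1U1 _ _).
  have /context_literalP c2 := cH2 _ (fset1U1 _ _).
  have [//|[bT e]] := replace_context orderC c1 gt1 c2 gt2 sub rep.
  (* An atom rewrites to [true], so the ill-formed literal [true = true]
     appears; it makes the conclusion redundant. *)
  case: nred; constructor 2; exists t2; rewrite !inE e.
  by rewrite bT eqxx orbT.
move=> M MO mu /sat_atomsU[sK /sat_atomsU[sG1 sG2]].
(* Either a side literal of one premise is true and survives in the conclusion, or both main
   literals are true and congruence applies. *)
have [|L /fset1UP[->|LH] sL] := S1 in1 MO (mu := mu); first exact/sat_atomsU.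
  have [|L' /fset1UP[->|LH'] sL'] := S1 in2 MO (mu := mu).
    exact/sat_atomsU.
    exists (lit b s2' t2); first by rewrite /= !inE eqxx !orbT.
    move: sL; rewrite /eqlit sat_litE => e; move: sL'; rewrite !sat_litE.
    by rewrite (subterm_teval sub rep e).
  by exists L'; rewrite //= !inE LH' !orbT.
by exists L; rewrite //= !inE LH.
Qed.

Lemma ineq_sound G H t :
  (G, neqlit t t |` H) \in clauses c ->
  sound_structure (add_clause D v c (G, H)).
Proof.
move=> inC; have [cG cH] := clauseC inC.
apply: add_clause_sound => //; first split=> // L LH.
  by apply: cH; rewrite inE LH orbT.
move=> M MO mu sG; have [//|L /fset1UP[->|LH] sL] := S1 inC MO (mu := mu).
  by move: sL; rewrite /neqlit sat_litE.
by exists L.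
Qed.

Lemma factor_sound G H s t t' :
  (G, H `|` [fset eqlit s t; eqlit s t']) \in clauses c ->
  gt_true (Defs.order c) s t' ->
  let C := (G, H `|` [fset neqlit t t'; eqlit s t']) in
  ~ redundant C (clauses c) -> sound_structure (add_clause D v c C).
Proof.
move=> inC gtst C nred; have [/= cG cH] := clauseC inC.
apply: add_clause_sound sD vc _ _; first split=> /= [|L]; first exact: cG.
  case/fsetUP=> [LH|/fset2P[->|->]].
  - by apply: cH; rewrite in_fsetU LH.
  - have /context_literalP c1 : context_literal (eqlit s t).
      by apply: cH; rewrite in_fsetU fset21 orbT.
    have /context_literalP c2 : context_literal (eqlit s t').
      by apply: cH; rewrite in_fsetU fset22 orbT.
    apply/context_literalP; have [//|e] := factor_context orderC c1 c2 gtst.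
    (* When [t = t'] the two equalities of the premise coincide, so the premise itself subsumes
       [C]. *)
    case: nred; constructor 3; rewrite /C -e in inC *.
    exists (G, H `|` [fset eqlit s t; eqlit s t]); first exact: inC.
    rewrite /=; apply/andP; split; first exact: fsubset_refl.
    by apply: fsetUS; apply/fsubsetP=> L' /fset2P[] ->; exact: fset22.
  - by apply: cH; rewrite in_fsetU fset22 orbT.
move=> M MO mu sG; have [|L LC sL] := S1 inC MO (mu := mu).
  by move: sG; rewrite /=.
(* If the values of [t] and [t'] differ, the new inequality is true; if they agree, a true [s = t]
   gives [s = t']. *)
have [e|ne] := pselect (teval mu t = teval mu t'); last first.
  exists (neqlit t t'); first by rewrite in_fsetU fset21 orbT.
  by rewrite /neqlit sat_litE.
case/fsetUP: LC sL => [LH|/fset2P[->|->]] sL.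
- by exists L; rewrite // in_fsetU LH.
- exists (eqlit s t'); first by rewrite in_fsetU fset22 orbT.
  by move: sL; rewrite /eqlit !sat_litE e.
- by exists (eqlit s t') => //; rewrite in_fsetU fset22 orbT.
Qed.

Lemma elim_sound C : sound_structure (set_clauses D v c (clauses c `\ C)).
Proof. by apply: set_clauses_sound => // C' /fsetD1P[_]; left. Qed.

(** [K1] collects the atoms whose image under [sigma f] is the head of a clause with empty body and
    no other literal; by (S1) the core of the source alone entails these images. *)
Lemma succ_edge_sound f core' :
  core' `<=` K1 O f (clauses c) ->
  entails O (fun M mu => @sat_atoms P1 P2 F M mu (core c) ->
    sat_atoms mu [fset psubst (sigma f) A | A in core']).
Proof.
move=> /fsubsetP sub M MO mu sK B /imfsetP[A /= /sub + ->].
rewrite !inE => /andP[_ inC].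
have [|L] := S1 inC MO (mu := mu).
  by apply/sat_atomsU; split=> // ?; rewrite inE.
by rewrite inE => /eqP-> /sat_atomE.
Qed.

End Context.

(** A valuation at [u] composed with [sigma f] is one at [v], and (S2) transfers the core along the
    edge. The clause of [v] can thus be the main premise of a hyperresolution at [u]. *)
Lemma pred_sound D u v f cu cv l n (A : 'I_l -> pterm P1 P2 F)
    (A' : 'I_n -> pterm P1 P2 F) G (H : 'I_l -> {fset literal P1 P2 F}) :
  sound_structure D -> (u, v, f) \in edges D ->
  (contexts D).[? u] = Some cu -> (contexts D).[? v] = Some cv ->
  ([fset A i | i : 'I_l], [fset atom (A' j) | j : 'I_n]) \in clauses cv ->
  (forall i, (G i, atom (psubst (sigma f) (A i)) |` H i) \in clauses cu) ->
  (forall j, Pr O (A' j)) ->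
  sound_structure (add_clause D u cu (\bigcup_(i in 'I_l) G i,
    \bigcup_(i in 'I_l) H i `|`
      [fset atom (psubst (sigma f) (A' j)) | j : 'I_n])).
Proof.
move=> sD uv uD vD inC prem prA'; have [[edgeD ctxD] [S1 S2]] := sD.
have [_ clauseC _] := ctxD _ _ uD.
apply: add_clause_sound => //; first split=> [B|L] /=.
- case/bigfcupP=> i _ BG; have [h _] := clauseC _ (prem i); exact: h.
- case/fsetUP=> [/bigfcupP[i _ LH]|/imfsetP[j _ ->]].
    by have [_ h] := clauseC _ (prem i); apply: h; rewrite inE LH orbT.
  exact/Ctx_atom/Pr_sigma_context.
move=> M MO mu.
(* The head is written as the image of a set of literals, the form that hyperresolution produces. *)
have -> : [fset atom (psubst (sigma f) (A' j)) | j : 'I_n] =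
    [fset lsubst (sigma f) L | L in [fset atom (A' j) | j : 'I_n]].
  apply/fsetP=> L; apply/imfsetP/imfsetP=> [[j _ ->]|[_ /imfsetP[j _ ->] ->]].
    by exists (atom (A' j)); [exact: in_imfset|rewrite lsubst_atom].
  by exists j; rewrite ?lsubst_atom.
rewrite /= [X in (_, X)]fsetUC.
apply: (@hyperresolution_sound _ _ _ M mu (sigma f) _ (core cv) l A) => //.
- by move=> i; apply: S1 uD (prem i) M MO mu.
- exact: S1 vD inC M MO _.
- by move=> /(S2 _ _ _ _ _ uv uD vD M MO)/sat_atoms_subst.
Qed.

(** Reused or fresh, the target has core [core'], a part of [K1], which makes the new edge sound;
    the clauses added there are tautologies over triggers. *)
Lemma succ_sound D u cu f v core' gt' :
  sound_structure D -> (contexts D).[? u] = Some cu ->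
  core' `<=` K1 O f (clauses cu) -> context_term_order gtF O gt' ->
  match (contexts D).[? v] with None => True | Some c => core c = core' end ->
  let cv := match (contexts D).[? v] with
            | Some c => Context (core c) (clauses c)
                          (fun s t => Defs.order c s t && gt' s t)
            | None => Context core' fset0 gt'
            end in
  let cv' := Context (core cv)
               (clauses cv `|`
                  [fset taut_clause A' | A' in K2 O f cu `\` core cv])
               (Defs.order cv) in
  sound_structure
    (CStruct (contexts D).[v <- cv'] ((u, v, f) |` edges D)).
Proof.
move=> sD uD core'K gtO' coreV cv cv'; have [[edgeD ctxD] [S1 S2]] := sD.
have cvcore : core cv = core' by rewrite /cv; case: fnd coreV.
have core'S : core' `<=` Su O.
  by apply: fsubset_trans core'K _; apply/fsubsetP=> A; rewrite !inE => /andP[].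
have cvP : (forall C, C \in clauses cv ->
      context_clause C /\ entails_clause (core cv) C)
    /\ context_term_order gtF O (Defs.order cv).
  rewrite /cv; case E: fnd => [c|]; last by split=> // C; rewrite inE.
  have [cS cC cO] := ctxD _ _ E; split; last exact: context_term_orderI.
  by move=> C CU; split; [exact: cC|exact: S1 E CU].
have cv'P C : C \in clauses cv' -> context_clause C /\ entails_clause core' C.
  case/fsetUP=> [/cvP.1|/imfsetP[A /= AK ->]]; first by rewrite cvcore.
  have ASu : A \in Su O by move: AK; rewrite !inE => /and3P[].
  split; first split=> [B|L] /=; rewrite ?inE.
  - by move=> /eqP->; exact: (Su_context ASu).
  - by move=> /eqP->; apply: Ctx_atom; case/andP: (Su_context ASu).
  move=> M _ mu /sat_atomsU[_ sA]; exists (atom A); rewrite ?inE //.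
  by apply/sat_atomE/sA; rewrite inE.
have edgeV w1 w2 g : (w1, w2, g) \in edges D ->
    w1 \in contexts D /\ w2 \in contexts D.
  by move/edgeD/andP.
have uIn : u \in contexts D by rewrite -fndSome uD.
(* Existing contexts keep their cores, also when [w] is [v]. This preserves (S2) on old edges and
   covers a new edge from [u] to itself. *)
have coreE w cw : w \in contexts D -> (contexts D).[v <- cv'].[? w] = Some cw ->
    exists2 cw', (contexts D).[? w] = Some cw' & core cw = core cw'.
  rewrite fnd_set -fndSome; case: eqP => [->|_ _ wD]; last by exists cw.
  case E: fnd coreV => [c|] // cc' _ [<-]; exists c => //=.
  by rewrite cvcore cc'.
split; split.
- move=> w1 w2 g /fset1UP[[-> -> _]|/edgeV[w1D w2D]]; rewrite /= !inE ?eqxx.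
    by rewrite uIn orbT.
  by rewrite w1D w2D !orbT.
- move=> w cw /=; rewrite fnd_set; case: eqP => [_ [<-]|_ /ctxD //].
  by split=> /= [|C /cv'P[]//|]; [rewrite cvcore|exact: cvP.2].
- move=> w cw C /=; rewrite fnd_set; case: eqP => [_ [<-]|_ /S1]; last exact.
  by move=> /cv'P[_]; rewrite -cvcore.
- move=> w1 w2 g c1 c2 /= /fset1UP[[-> -> ->]|e].
    move=> /(coreE _ _ uIn)[c1']; rewrite uD => -[<-] ->.
    rewrite fnd_set eqxx => -[<-] /=; rewrite cvcore.
    exact: succ_edge_sound uD _ _ core'K.
  have [w1D w2D] := edgeV _ _ _ e.
  move=> /(coreE _ _ w1D)[c1' E1 ->] /(coreE _ _ w2D)[c2' E2 ->].
  exact: S2 e E1 E2.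
Qed.

End Preservation.

Theorem theorem1 (P1 P2 F W : countType) (gtF : rel F)
    (O : {fset clause P1 P2 F}) (D D' : cstruct P1 P2 F W)
    (enc : encoding P1 P2 F W) (strat : strategy_type P1 P2 F W) :
  wf_total_order gtF ->
  ontology O ->
  context_structure gtF O D ->
  sound O D ->
  expansion_strategy gtF O enc strat ->
  step O strat D D' ->
  context_structure gtF O D' /\ sound O D'.
Proof.
move=> _ ontO ctxD soundD [_ stratP] st.
have sD : sound_structure gtF O D by [].
case: st.
- by move=> v c A vc Ac _; apply: core_sound.
- move=> v c n A Hd sg G H vc inO sgX prem _ C _.
  exact: (hyper_sound sD vc ontO inO sgX prem).
- move=> v c G1 H1 s1 t1 G2 H2 b s2 t2 p s2' vc in1 gt1 _ in2 gt2 _ sub rep C.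
  exact: (eq_sound sD vc in1 gt1 in2 gt2 sub rep).
- by move=> v c G H t vc inC _; apply: ineq_sound inC.
- by move=> v c G H s t t' vc inC _ gtst C; apply: factor_sound.
- by move=> v c C vc _ _; apply: elim_sound.
- move=> u v f cu cv l n A A' G H uv uD vD inC prem _ prA' C _.
  exact: (pred_sound sD uv uD vD inC prem prA').
- move=> u cu f G H A p v core' gt' uD _ _ _ _ sE.
  have := stratP f (K1 O f (clauses cu)) D ctxD; rewrite sE => -[].
  exact: succ_sound.
Qed.
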